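(* Let $m\ge 1$ be an integer and let $\{V_B:B\in C_m\}$ be a complete set of exponent measures. Then $\{V_B:B\in C_m\}$ is consistent if and only if $$\sum_{B\in C_m,\ B\supseteq M_m\setminus L}(-1)^{|B\cap L|+1}\,V_B(y_B)\ \ge\ 0\qquad\text{for all } y_{M_m}\in(0,\infty)^m \text{ and all } L\in C_m.$$
   Context: Notation: $M_m=\{1,\ldots,m\}$; $C_m=2^{M_m}\setminus\{\emptyset\}$ is the collection of all non-empty subsets of $M_m$; $y_{M_m}=(y_1,\ldots,y_m)\in(0,\infty)^m$, and for $B\in C_m$, $y_B=\{y_i:i\in B\}$ is the subvector of $y_{M_m}$ indexed by $B$. For $B\in C_m$, $S_B=\{(w_i)_{i\in B}\in[0,\infty)^{B}:\sum_{i\in B}w_i=1\}$ is the unit simplex, and $S_m=S_{M_m}$. Exponent measure: a function $V_B:(0,\infty)^B\to(0,\infty)$ is an exponent measure (of the variables indexed by $B$) if $\exp\{-V_B\}$ is the distribution function of a max-stable random vector indexed by $B$ with unit Fréchet margins ($\exp(-1/y)$, $y>0$), i.e. if there is a finite (non-negative Borel) measure $H_B$ on $S_B$ with $\int_{S_B}w_i\,dH_B(w)=1$ for every $i\in B$ and $$V_B(y_B)=\int_{S_B}\max_{i\in B}\left(\frac{w_i}{y_i}\right)dH_B(w),\qquad y_B\in(0,\infty)^B.$$ A complete set of exponent measures is a family $\{V_B:B\in C_m\}$ containing one exponent measure $V_B$ for each of the $2^m-1$ non-empty subsets $B$ of $M_m$ (a priori the measures $H_B$ for different $B$ need not be related).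 A complete set $\{V_B:B\in C_m\}$ is called consistent if there is a single finite measure $H$ on $S_m$ satisfying $\int_{S_m}w_i\,dH(w_1,\ldots,w_m)=1$ for every $i\in M_m$ such that $$V_B(y_B)=\int_{S_m}\max_{j\in B}\left(\frac{w_j}{y_j}\right)dH(w_1,\ldots,w_m)$$ for every $B\in C_m$ and every $y_{M_m}\in(0,\infty)^m$. *)

(* Defs.v *)
From HB Require Import structures.
From mathcomp Require Import all_boot all_order all_algebra.
From mathcomp Require Import all_classical all_reals all_analysis.
Import Order.TTheory GRing.Theory Num.Theory numFieldNormedType.Exports.

Set Implicit Arguments.
Unset Strict Implicit.
Unset Printing Implicit Defensive.

Local Open Scope classical_set_scope.
Local Open Scope ring_scope.

(* R^I with the Borel sigma-algebra of its product topology *)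
Definition borelRn (R : realType) (I : finType) :=
  g_sigma_algebraType (@open {ptws I -> R}).
HB.instance Definition _ (R : realType) (I : finType) :=
  Measurable.on (borelRn R I).

(* The coordinates are indexed by a finite type I, which is instantiated with
   'I_m for S_m and with the type of elements of B for S_B. *)
Definition unit_simplex (R : realType) (I : finType) : set (borelRn R I) :=
  [set w | (forall i, 0 <= w i) /\ \sum_i w i = 1].
Arguments unit_simplex : clear implicits.

(* A finite Borel measure on the simplex is encoded as a finite Borel measure
   on R^I that vanishes outside the simplex: the simplex is not always a
   measurableType of its own, as these are inhabited and it is empty when I
   is. *)
Definition spectral_measure (R : realType) (I : finType)
    (H : {finite_measure set (borelRn R I) -> \bar R}) : Prop :=
  H (~` unit_simplex R I) = 0%E /\
  forall i : I, (\int[H]_(w in unit_simplex R I) (w i)%:E = 1)%E.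

(* Spectral representation of the V such that exp (- V) is the distribution
   function of a max-stable vector with unit Frechet margins. Here and in
   consistent, the ratios are nonnegative on the simplex, so starting the
   maximum from 0 does not alter it as soon as its range is nonempty. *)
Definition is_exponent_measure (R : realType) (I : finType)
    (V : (I -> {posnum R}) -> {posnum R}) : Prop :=
  exists2 H : {finite_measure set (borelRn R I) -> \bar R},
    spectral_measure H &
    forall y : I -> {posnum R},
      ((V y)%:num%:E =
       \int[H]_(w in unit_simplex R I)
         (\big[Num.max/0]_(i : I) (w i / (y i)%:num))%:E)%E.

(* C_m, with M_m represented by 'I_m = {0, ..., m - 1} *)
Definition nonempty_subset (m : nat) : Type :=
  {B : {set 'I_m} | B != finset.set0}.

Definition elt (m : nat) (B : nonempty_subset m) : Type :=
  {i : 'I_m | i \in \val B}.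

Definition subvector (T : Type) (m : nat) (y : 'I_m -> T)
    (B : nonempty_subset m) : elt B -> T :=
  fun i => y (\val i).
Arguments subvector {T m} y B i.

Definition positive_family (R : realType) (m : nat) : Type :=
  forall B : nonempty_subset m, (elt B -> {posnum R}) -> {posnum R}.

Definition complete_set (R : realType) (m : nat)
    (V : positive_family R m) : Prop :=
  forall B : nonempty_subset m, is_exponent_measure (V B).

Definition consistent (R : realType) (m : nat)
    (V : positive_family R m) : Prop :=
  exists2 H : {finite_measure set (borelRn R 'I_m) -> \bar R},
    spectral_measure H &
    forall (B : nonempty_subset m) (y : 'I_m -> {posnum R}),
      ((V B (subvector y B))%:num%:E =
       \int[H]_(w in unit_simplex R 'I_m)
         (\big[Num.max/0]_(j in \val B) (w j / (y j)%:num))%:E)%E.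

(* Main.v *)
(* Write M for the index set.  For a set function v vanishing on the empty set,
   put f_L = \sum_(B contains M \ L) (-1)^(|B & L| + 1) v(B).  By Moebius
   inversion, v(M) - v(B) is the sum of the f_L over the nonempty L disjoint
   from B; hence, if f_L >= 0 for every nonempty L, then
     0 <= v(M) - v(B) <= \sum_(i notin B) v({i}).
   When v(B) is the maximum of the a_j >= 0 over j in B, f_L is
   the positive part of min_L a - max_(M \ L) a; integrating against H, this
   gives the inequalities for a consistent family.  Conversely, let U be the
   family generated by the spectral measure of V_M.  Both U and V satisfy the
   bounds above, where v({i}) = 1 / y_i, and U_M = V_M; since U_B and V_B do not
   depend on the y_i with i notin B, letting these tend to infinity gives
   U_B = V_B. *)
From HB Require Import structures.
Require Import Defs.
From mathcomp Require Import all_boot all_order all_algebra.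
From mathcomp Require Import all_classical all_reals all_analysis.
From mathcomp Require Import measurable_realfun lra.
Import Order.TTheory GRing.Theory Num.Theory numFieldNormedType.Exports.
Local Open Scope ring_scope.

(** * Alternating sums of set functions *)

(** The $f_L$ of the overview. For [L] the full set the range includes the empty set, whose term
    vanishes exactly when [v] does there. *)
Definition alt_sum {R : pzRingType} {I : finType} (v : {set I} -> R)
    (L : {set I}) : R :=
  \sum_(B : {set I} | (~: L)%SET \subset B) (-1) ^+ (#|(B :&: L)%SET| + 1) * v B.

Lemma sum_setU1 {R : nmodType} {I : finType} (i : I) (F : {set I} -> R) :
  \sum_B F B = \sum_(B : {set I} | i \notin B) (F B + F (i |: B)%SET).
Proof.
rewrite (bigID (fun B : {set I} => i \notin B)) /= big_split /=; congr +%R.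
rewrite (reindex_onto (fun B => i |: B)%SET (fun B => B :\ i)%SET) /=; last first.
  by move=> B; rewrite negbK => iB; rewrite finset.setD1K.
apply: eq_bigl => B; rewrite negbK finset.setU11 /=.
apply/eqP/idP => [<-|iB]; first by rewrite finset.setD11.
by rewrite finset.setU1K.
Qed.

Lemma setU1I_card {I : finType} (i : I) (B L : {set I}) : i \notin B -> i \in L ->
  #|((i |: B) :&: L)%SET| = #|(B :&: L)%SET|.+1.
Proof.
move=> iB iL; rewrite finset.setIUl (finset.setIidPl _) ?finset.sub1set//.
by rewrite cardsU1 !inE (negbTE iB).
Qed.

(** The coefficient of [v C] is a signed count of the [L] between [~: C] and [~: B]. Toggling in [L]
    an element of [C] outside [B] makes it cancel unless [C] is [B], where only [L = ~: B] remains,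
    with sign -1. *)
Lemma sum_alt_sum {R : pzRingType} {I : finType} (v : {set I} -> R) (B : {set I}) :
  \sum_(L : {set I} | L \subset (~: B)%SET) alt_sum v L = - v B.
Proof.
pose g (C L : {set I}) : R :=
  if (L \subset ~: B)%SET && (~: L \subset C)%SET
  then (-1) ^+ (#|(C :&: L)%SET| + 1) else 0.
transitivity (\sum_C (\sum_L g C L) * v C).
  under [RHS]eq_bigr do rewrite big_distrl/=.
  rewrite exchange_big/= big_mkcond/=; apply: eq_bigr => L _; rewrite /g.
  case: ifPn => LB /=; last by rewrite big1// => C _; rewrite mul0r.
  rewrite /alt_sum big_mkcond/=; apply: eq_bigr => C _.
  by case: ifP => // _; rewrite mul0r.
rewrite (bigD1 B)//= [X in _ + X]big1 ?addr0; last first.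
  move=> C CB; rewrite (_ : \sum_L g C L = 0) ?mul0r//.
  have [BC|BC] := boolP (B \subset C); last first.
    apply: big1 => L _; rewrite /g; case: ifPn => // /andP[LB LC].
    by case/negP: BC; apply: fintype.subset_trans LC; rewrite finset.subsetC.
  have /fintype.properP[_ [i iC iB]] : B \proper C by rewrite finset.properEneq eq_sym CB.
  (* L and i |: L contribute opposite signs *)
  rewrite (sum_setU1 i); apply: big1 => L iL; rewrite /g.
  rewrite finset.subUset finset.sub1set inE iB /= finset.setCU.
  have -> : (~: [set i] :&: ~: L \subset C)%SET = (~: L \subset C)%SET.
    apply/fintype.subsetP/fintype.subsetP => H x xL.
      have [->//|xi] := eqVneq x i.
      by apply: H; rewrite !inE xi; move: xL; rewrite inE.
    by apply: H; move: xL; rewrite !inE => /andP[].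
  case: ifP => _; last by rewrite addr0.
  rewrite finset.setIC [(C :&: (_ :|: _))%SET]finset.setIC setU1I_card//.
  by rewrite !addn1 !exprS !mulN1r opprK addNr.
rewrite (bigD1 (~: B)%SET)//= big1 ?addr0.
  rewrite /g subxx finset.setCK subxx /= finset.setICr cards0 expr1.
  by rewrite mulN1r.
move=> L LB; rewrite /g; case: ifPn => // /andP[LB1 BL1]; case/negP: LB.
by rewrite finset.eqEsubset LB1 finset.subCset.
Qed.

(** The term of the empty [L] in [sum_alt_sum] is [- v setT]; it is moved to the other side. *)
Lemma sum_alt_sum_neq0 {R : pzRingType} {I : finType} (v : {set I} -> R) (B : {set I}) :
  \sum_(L : {set I} | (L != finset.set0) && (L \subset (~: B)%SET)) alt_sum v L
  = v finset.setT - v B.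
Proof.
apply/(addrI (- v finset.setT)); rewrite addKr.
rewrite -[in RHS]sum_alt_sum [in RHS](bigD1 finset.set0) ?finset.sub0set//=.
congr (_ + _); last by apply: eq_bigl => L; rewrite andbC.
rewrite /alt_sum finset.setC0 (big_pred1 finset.setT) => [|C].
  by rewrite finset.setI0 cards0 expr1 mulN1r.
by rewrite finset.subTset.
Qed.

Lemma alt_sum_bounds {R : realDomainType} {I : finType} (v : {set I} -> R) (B : {set I}) :
  v finset.set0 = 0 -> (forall L, L != finset.set0 -> 0 <= alt_sum v L) ->
  0 <= v finset.setT - v B <= \sum_(i in (~: B)%SET) v [set i]%SET.
Proof.
move=> v0 vge0; have sumv := sum_alt_sum_neq0 v.
(* Subtracting the inversion formula at [[set i]] from the one at the empty set leaves the [L] that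
   contain [i]. *)
have v1 i : v [set i]%SET = \sum_(L : {set I} | i \in L) alt_sum v L.
  have := sumv finset.set0; rewrite v0 subr0.
  rewrite (bigID (fun L : {set I} => i \notin L)) /=.
  rewrite (eq_bigl (fun L : {set I} =>
    (L != finset.set0) && (L \subset (~: [set i])%SET))); last first.
    by move=> L; rewrite finset.setC0 finset.subsetT andbT finset.subsetC finset.sub1set inE.
  rewrite sumv (eq_bigl (fun L : {set I} => i \in L)); last first.
    move=> L; rewrite negbK finset.setC0 finset.subsetT andbT.
    by case: eqVneq => // ->; rewrite inE.
  lra.
rewrite -sumv; apply/andP; split.
  by apply: sumr_ge0 => L /andP[L0 _]; apply: vge0.
(* Once the sums are exchanged, the right side counts each [L] once per element of [L] outside [B],
   hence at least once when [L] is nonempty and disjoint from [B]. *)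
under [leRHS]eq_bigr do rewrite v1 big_mkcond/=.
rewrite exchange_big/= big_mkcond/=; apply: ler_sum => L _.
have ge0 i : 0 <= if i \in L then alt_sum v L else 0.
  by case: ifPn => // iL; apply: vge0; apply/finset.set0Pn; exists i.
case: ifPn => [/andP[/finset.set0Pn[i iL] /fintype.subsetP LB]|_]; last by apply: sumr_ge0.
by rewrite (bigD1 i)/= ?iL ?LB// lerDl; apply: sumr_ge0.
Qed.

Lemma alt_sum_bigmax_ge0 {R : realDomainType} {I : finType} (a : I -> R) (L : {set I}) :
  L != finset.set0 ->
  0 <= alt_sum (fun B => \big[Num.max/0]_(j in B) a j) L.
Proof.
move=> /finset.set0Pn[i0 i0L].
set v := fun B => _.
have vmono (B C : {set I}) : B \subset C -> v B <= v C.
  move=> /fintype.subsetP BC.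
  apply: bigmax_le => [|j jB]; first exact: bigmax_ge_id.
  by apply: le_bigmax_cond; apply: BC.
(* Pair B with i |: B, where i minimizes a on L: the two terms cancel as soon as
   B meets L. *)
case: (Order.TotalTheory.arg_minP a i0L) => i iL imin.
rewrite /alt_sum big_mkcond /= (sum_setU1 i); apply: sumr_ge0 => B iB.
have -> : (~: L \subset i |: B)%SET = (~: L \subset B)%SET.
  apply/fintype.subsetP/fintype.subsetP => H x xL; last first.
    by rewrite !inE H ?orbT.
  by have := H x xL; move: xL; rewrite !inE => /negP xL /orP[/eqP xi|//]; case: xL; rewrite xi.
case: ifPn => // LB.
rewrite setU1I_card// addSn exprS mulN1r mulNr -mulrBr.
(* When [B] misses [L], the pair contributes [v (i |: B) - v B], nonnegative by monotonicity. *)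
have [/eqP BL0|/finset.set0Pn[j]] := boolP (B :&: L == finset.set0)%SET.
  by rewrite BL0 cards0 expr1 mulN1r oppr_ge0 subr_le0; apply/vmono/finset.subsetUr.
rewrite inE => /andP[jB jL].
(* For [j] in both [B] and [L], [a j] is at least [a i], so adding [i] leaves the maximum
   unchanged. *)
rewrite (_ : v B = v (i |: B)%SET) ?subrr ?mulr0//.
apply/le_anti/andP; split; first exact/vmono/finset.subsetUr.
apply: bigmax_le => [|k]; first exact: bigmax_ge_id.
rewrite !inE => /orP[/eqP->|kB]; last exact: le_bigmax_cond.
exact: le_trans (imin _ jL) (le_bigmax_cond _ _ jB).
Qed.

(** * Measurability on [borelRn] and on the simplex *)

Lemma continuous_to_prod {J : choiceType} {T : topologicalType}
    {U : J -> topologicalType} (f : T -> prod_topology U) :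
  (forall j, continuous (fun x => f x j)) -> continuous f.
Proof.
move=> cf x; apply/cvg_sup.
move=> j; move: x; apply/(@continuousP _ (initial_topology (@proj J U j))).
by move=> _ [B oB <-]; exact: (continuousP _).1 (cf j) B oB.
Qed.

Lemma measurable_bigmax {d} {T : measurableType d} {R : realType} {I : Type}
    (D : set T) (x : R) (r : seq I) (P : pred I) (F : I -> T -> R) :
  (forall i, measurable_fun D (F i)) ->
  measurable_fun D (fun t => \big[Num.max/x]_(i <- r | P i) F i t).
Proof.
move=> mF; elim: r => [|i r IHr].
  by under eq_fun do rewrite big_nil; exact: measurable_cst.
under eq_fun do rewrite big_cons; case: (P i) => //.
exact: measurable_maxr.
Qed.

Section spectral.
Local Open Scope classical_set_scope.
Context {R : realType}.

Lemma measurable_borelRn_coord {I : finType} (i : I) :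
  measurable_fun [set: borelRn R I] (fun w : borelRn R I => w i).
Proof.
apply: (measurability _ (RGenOpens.measurableE R)).
move=> _ [_ [a [b ->] <-]]; rewrite setTI; apply: sub_sigma_algebra.
apply: (continuousP _).1; last exact: interval_open.
exact: (@proj_continuous I (fun _ => R : topologicalType) i).
Qed.

(** The map is continuous because its coordinates are projections, and open sets generate both
    sigma-algebras. *)
Lemma measurable_borelRn_comp {I J : finType} (s : J -> I) :
  measurable_fun [set: borelRn R I] ((fun w j => w (s j)) : borelRn R I -> borelRn R J).
Proof.
apply: (@measurability _ _ (borelRn R I) (borelRn R J) setT _ (@open {ptws J -> R}) erefl).
move=> _ [U oU <-]; rewrite setTI; apply: sub_sigma_algebra.
pose f : {ptws I -> R} -> {ptws J -> R} := fun w j => w (s j).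
suff cf : continuous f by exact: (continuousP f).1 cf U oU.
have cs j : continuous ((fun w => w (s j)) : {ptws I -> R} -> R).
  exact: (@proj_continuous I (fun _ => R : topologicalType) (s j)).
exact: (@continuous_to_prod J {ptws I -> R} (fun _ => R : topologicalType) f cs).
Qed.

Lemma measurable_unit_simplex {I : finType} : measurable (unit_simplex R I).
Proof.
rewrite (_ : unit_simplex R I =
  (\big[setI/setT]_(i : I) ((fun w : borelRn R I => w i) @^-1` `[0, +oo[)) `&`
  ((fun w : borelRn R I => \sum_i w i) @^-1` [set 1])); last first.
  apply/seteqP; split=> w /=.
    move=> [w0 ->]; split=> //; rewrite -bigcap_seq => i _ /=.
    by rewrite in_itv/= andbT.
  rewrite -bigcap_seq => -[w0 w1]; split=> [i|//].
  by have := w0 i (mem_index_enum _); rewrite /= in_itv/= andbT.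
apply: measurableI.
  apply: bigsetI_measurable => i _; rewrite -[X in measurable X]setTI.
  by apply: measurable_borelRn_coord => //; exact: measurable_itv.
rewrite -[X in measurable X]setTI.
by apply: measurable_sum => // i; exact: measurable_borelRn_coord.
Qed.

Lemma measurable_bigmax_ratio {I : finType} (P : {pred I}) (y : I -> {posnum R}) :
  measurable_fun [set: borelRn R I]
    (fun w : borelRn R I => \big[Num.max/0]_(j in P) (w j / (y j)%:num)).
Proof.
apply: measurable_bigmax => j.
by apply: measurable_funM => //; exact: measurable_borelRn_coord.
Qed.

(** * Integrals against a spectral measure *)

Section integral.
Context {I : finType} (H : {finite_measure set (borelRn R I) -> \bar R}).
Hypothesis specH : spectral_measure H.
Local Notation S := (unit_simplex R I).

Lemma integrable_coord i : H.-integrable S (fun w => (w i)%:E).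
Proof.
apply/integrableP; split.
  by apply/measurable_EFinP/measurable_funTS; exact: measurable_borelRn_coord.
rewrite (_ : \int[H]_(x in S) _ = 1)%E ?ltry// -(specH.2 i).
by apply: eq_integral => w /[!inE] -[w0 _]; rewrite gee0_abs ?lee_fin.
Qed.

(** On the simplex the ratios are nonnegative, so their maximum is dominated by their sum, which is
    integrable by the moment conditions. *)
Lemma integrable_bigmax_ratio (B : {set I}) (y : I -> {posnum R}) :
  H.-integrable S (EFin \o fun w : borelRn R I => \big[Num.max/0]_(j in B) (w j / (y j)%:num)).
Proof.
have mS := @measurable_unit_simplex I.
apply: (le_integrable mS
  (g := fun w : borelRn R I => (\sum_j ((y j)%:num^-1)%:E * (w j)%:E)%E)) => //.
- by apply/measurable_EFinP/measurable_funTS; exact: measurable_bigmax_ratio.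
- move=> w [w0 _] /=; rewrite sumEFin /= lee_fin.
  rewrite !ger0_norm ?sumr_ge0//; last exact: bigmax_ge_id; last first.
    by move=> i _; rewrite mulr_ge0// invr_ge0.
  apply: bigmax_le => [|i _].
    by apply: sumr_ge0 => i _; rewrite mulr_ge0// invr_ge0.
  rewrite (bigD1 i)//= mulrC lerDl sumr_ge0// => j _.
  by rewrite mulr_ge0// invr_ge0.
- by apply: integrable_sum => // j _; apply: integrableZl => //; exact: integrable_coord.
Qed.

(** The $U_B$ of the overview, all generated by one measure. The integral is real-valued so that
    [alt_sum] applies. *)
Definition spectral_max (y : I -> {posnum R}) (B : {set I}) : R :=
  \int[H]_(w in S) \big[Num.max/0]_(j in B) (w j / (y j)%:num).

Lemma EFin_spectral_max y B : (spectral_max y B)%:E =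
  (\int[H]_(w in S) (\big[Num.max/0]_(j in B) (w j / (y j)%:num))%:E)%E.
Proof.
rewrite /spectral_max /Rintegral fineK//.
by apply: integrable_fin_num (integrable_bigmax_ratio B y); exact: measurable_unit_simplex.
Qed.

Lemma spectral_max0 y : spectral_max y finset.set0 = 0.
Proof.
rewrite /spectral_max (@eq_Rintegral _ _ _ _ _ (cst 0)) ?Rintegral_cst ?mul0r//.
  exact: measurable_unit_simplex.
by move=> w _ /=; rewrite big_pred0// => j; rewrite inE.
Qed.

Lemma spectral_max1 y i : spectral_max y [set i]%SET = (y i)%:num^-1.
Proof.
rewrite /spectral_max (@eq_Rintegral _ _ _ _ _ (fun w : borelRn R I => w i * (y i)%:num^-1)).
  rewrite RintegralZr; [|exact: measurable_unit_simplex|exact: integrable_coord].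
  by rewrite /Rintegral specH.2 mul1r.
move=> w /[!inE] -[w0 _] /=.
by rewrite bigmax_set1 max_l// mulr_ge0// invr_ge0.
Qed.

(** By linearity this is the integral of an alternating sum of maxima, which is nonnegative
    pointwise. *)
Lemma spectral_max_alt_sum_ge0 y (L : {set I}) : L != finset.set0 ->
  0 <= alt_sum (spectral_max y) L.
Proof.
move=> L0; have mS := @measurable_unit_simplex I.
rewrite -lee_fin -sumEFin.
under eq_bigr => B _ do
  rewrite EFinM EFin_spectral_max -(integralZl mS (integrable_bigmax_ratio B y)).
rewrite -integral_sum//; last first.
  by move=> B; apply: integrableZl => //; exact: integrable_bigmax_ratio.
apply: integral_ge0 => w Sw; under eq_bigr do rewrite -EFinM.
by rewrite sumEFin lee_fin; exact: alt_sum_bigmax_ge0.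
Qed.

End integral.

End spectral.

(** * Relabelling the coordinates of a spectral measure *)

Section transport.
Local Open Scope classical_set_scope.
Context {R : realType} {I J : finType} (t : I -> J) (s : J -> I).
Hypotheses (ts : cancel t s) (st : cancel s t).
Context (H : {finite_measure set (borelRn R J) -> \bar R}).
Local Notation phi := ((fun w i => w (t i)) : borelRn R J -> borelRn R I).

Lemma ex_reindex_measure : exists H' : {finite_measure set (borelRn R I) -> \bar R},
  (H' : set _ -> \bar R) = pushforward H phi.
Proof.
have mphi := @measurable_borelRn_comp R J I t.
pose mu : {measure set (borelRn R I) -> \bar R} :=
  measure_function_pushforward__canonical__measure_function_Measure H mphi.
have fin : fin_num_fun mu.
  move=> A mA; apply: fin_num_measure; rewrite -[X in measurable X]setTI.
  exact: (mphi measurableT A mA).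
pose F := Measure_isFinite.Build _ _ _ mu fin.
pose nu : {finite_measure set (borelRn R I) -> \bar R} := HB.pack (mu : set _ -> \bar R) mu F.
by exists nu.
Qed.

Lemma preimage_unit_simplex : phi @^-1` (unit_simplex R I) = unit_simplex R J.
Proof.
have sumE (w : J -> R) : \sum_i w (t i) = \sum_j w j.
  by rewrite [RHS](reindex t)//; exists s => // ? _.
apply/seteqP; split=> w /= -[w0 w1]; split.
- by move=> j; rewrite -(st j).
- by rewrite -sumE.
- by move=> i; exact: w0.
- by rewrite sumE.
Qed.

(** Serves to carry the spectral measure of [V] at the full set, which lives over the type of
    elements of that set, to ['I_m]. *)
Lemma ex_reindex_spectral_measure : spectral_measure H ->
  exists2 H' : {finite_measure set (borelRn R I) -> \bar R}, spectral_measure H' &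
    forall y : I -> {posnum R},
     (\int[H']_(w in unit_simplex R I) (\big[Num.max/0]_i (w i / (y i)%:num))%:E =
      \int[H]_(w in unit_simplex R J) (\big[Num.max/0]_j (w j / (y (s j))%:num))%:E)%E.
Proof.
move=> [H0 H1]; have [H' H'E] := ex_reindex_measure; exists H'.
  split=> [|i].
    by rewrite H'E /pushforward -preimage_setC preimage_unit_simplex.
  rewrite H'E (ge0_integral_pushforward (measurable_borelRn_comp t)).
  - by rewrite preimage_unit_simplex; exact: H1.
  - exact: measurable_unit_simplex.
  - by apply/measurable_EFinP/measurable_funTS; exact: measurable_borelRn_coord.
  - by move=> w /[!inE] -[w0 _]; rewrite lee_fin.
move=> y; rewrite H'E (ge0_integral_pushforward (measurable_borelRn_comp t)).
- rewrite preimage_unit_simplex; apply: eq_integral => w _ /=; congr EFin.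
  rewrite [RHS](reindex t)/=; last by exists s => // ? _.
  by apply: eq_bigr => i _; rewrite ts.
- exact: measurable_unit_simplex.
- apply/measurable_EFinP/measurable_funTS/measurable_bigmax => i.
  by apply: measurable_funM => //; exact: measurable_borelRn_coord.
- by move=> w _; rewrite lee_fin; exact: bigmax_ge_id.
Qed.

End transport.

(* The value 0 at the empty set matches the empty maximum. *)
Definition extension {R : realType} {m : nat} (V : positive_family R m)
    (y : 'I_m -> {posnum R}) (B : {set 'I_m}) : R :=
  if insub B is Some C then (V C (subvector y C))%:num else 0.

Lemma extension_val {R : realType} {m : nat} (V : positive_family R m) y B :
  extension V y (\val B) = (V B (subvector y B))%:num.
Proof. by rewrite /extension valK. Qed.

Lemma extension0 {R : realType} {m : nat} (V : positive_family R m) y :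
  extension V y finset.set0 = 0.
Proof. by rewrite /extension insubF ?eqxx. Qed.

(** Links the sum in the theorem, over a subtype, to [alt_sum]: the additional term at the empty set
    is zero. *)
Lemma sum_nonempty_subset {R : pzRingType} {m : nat} (v : {set 'I_m} -> R) (L : {set 'I_m}) :
  v finset.set0 = 0 ->
  \sum_(B : nonempty_subset m | (~: L)%SET \subset \val B)
     (-1) ^+ (#|(\val B :&: L)%SET| + 1) * v (\val B) = alt_sum v L.
Proof.
move=> v0; rewrite -(big_sub_cond [pred B : {set 'I_m} | B != finset.set0]
  (fun B => ~: L \subset B)%SET (fun B => (-1) ^+ (#|(B :&: L)%SET| + 1) * v B)).
rewrite /alt_sum [RHS](bigID (fun B => B != finset.set0))/= [X in _ + X]big1 ?addr0.
  by apply: eq_bigl => B; rewrite andbC.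
by move=> B /andP[_ /negPn/eqP->]; rewrite v0 mulr0.
Qed.


(** * Uniqueness of a family with given value at the full set *)

(** The properties shared by $U$ and $V$ in the overview that make the limiting argument work. *)
Record alternating_family {R : realType} {I : finType}
    (f : (I -> {posnum R}) -> {set I} -> R) : Prop := {
  family_set0 : forall y, f y finset.set0 = 0 ;
  family_set1 : forall y i, f y [set i]%SET = (y i)%:num^-1 ;
  family_local : forall (B : {set I}) y z, {in B, y =1 z} -> f y B = f z B ;
  family_alt_sum_ge0 : forall y L, L != finset.set0 -> 0 <= alt_sum (f y) L }.

Lemma alternating_family_eq {R : realType} {I : finType}
    (f g : (I -> {posnum R}) -> {set I} -> R) :
  alternating_family f -> alternating_family g ->
  (forall y, f y finset.setT = g y finset.setT) -> forall y B, f y B = g y B.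
Proof.
move=> fP gP fgT y B.
apply/eqP; rewrite -subr_eq0 -normr_le0; apply/ler_addgt0Pr => e e0; rewrite add0r.
(* The successor keeps [n] positive even when [I] is empty. *)
pose n : R := #|I|.+1%:R.
have n0 : 0 < n by rewrite ltr0n.
have ne0 : 0 < n / e by rewrite divr_gt0.
(* Instead of a limit, the coordinates outside [B] are set to [n / e]: each adds [e / n] to the
   upper bound of [alt_sum_bounds], at most [e] in total. *)
pose z i : {posnum R} := if i \in B then y i else PosNum ne0.
have yz : {in B, y =1 z} by move=> i iB; rewrite /z iB.
have sum_le : \sum_(i in (~: B)%SET) (z i)%:num^-1 <= e.
  rewrite (eq_bigr (fun=> e / n)) => [|i]; last first.
    by rewrite inE /z => /negbTE-> /=; rewrite invf_div.
  rewrite sumr_const -mulr_natr mulrAC ler_pdivrMr// ler_pM2l// ler_nat.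
  exact/leqW/max_card.
have bounds h : alternating_family h ->
    0 <= h z finset.setT - h z B <= e.
  move=> [h0 h1 _ hge0].
  have /andP[-> /le_trans->//] := alt_sum_bounds (h z) B (h0 z) (hge0 z).
  by under eq_bigr do rewrite h1.
(* Both values at [B] lie at most [e] below the common value at [setT], hence within [e] of each
   other. *)
rewrite (family_local _ fP _ _ _ yz) (family_local _ gP _ _ _ yz) ler_norml.
have := bounds f fP; rewrite fgT => /andP[f_le le_f].
have /andP[g_le le_g] := bounds g gP; apply/andP; split; lra.
Qed.

Lemma spectral_max_alternating {R : realType} {I : finType}
    (H : {finite_measure set (borelRn R I) -> \bar R}) :
  spectral_measure H -> alternating_family (spectral_max H).
Proof.
move=> specH; split.
- exact: spectral_max0.
- exact: spectral_max1.
- move=> B y z yz; apply: eq_Rintegral => w _; apply: eq_bigr => j jB.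
  by rewrite yz.
- exact: spectral_max_alt_sum_ge0.
Qed.

(** Over a one-element index set the maximum is a single ratio, and the moment condition gives its
    integral. *)
Lemma extension_set1 {R : realType} {m : nat} (V : positive_family R m) :
  complete_set V -> forall y i, extension V y [set i]%SET = (y i)%:num^-1.
Proof.
move=> VP y i; have i0 : [set i]%SET != finset.set0.
  by apply/finset.set0Pn; exists i; rewrite inE.
pose B : nonempty_subset m := exist _ [set i]%SET i0.
rewrite -[[set i]%SET]/(\val B) extension_val.
have [H specH VE] := VP B; apply: EFin_inj; rewrite VE.
pose j0 : elt B := exist _ i (finset.set11 i).
rewrite -[y i]/(subvector y B j0) -(spectral_max1 _ specH) EFin_spectral_max//.
apply: eq_integral => w _; congr EFin; apply: eq_bigl => j.
by rewrite inE; symmetry; apply/eqP/val_inj/finset.set1P; exact: (valP j).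
Qed.

Lemma extension_local {R : realType} {m : nat} (V : positive_family R m)
    (B : {set 'I_m}) y z :
  {in B, y =1 z} -> extension V y B = extension V z B.
Proof.
move=> yz; rewrite /extension; case: insubP => // C _ CB.
by congr (V C _)%:num; apply/funext => j; apply: yz; rewrite -CB; exact: (valP j).
Qed.

Theorem corollary1 (R : realType) (m : nat) (V : positive_family R m) :
  (1 <= m)%N ->
  complete_set V ->
  (consistent V <->
   forall (y : 'I_m -> {posnum R}) (L : nonempty_subset m),
     0 <= \sum_(B : nonempty_subset m | (~: \val L)%SET \subset \val B)
            (-1) ^+ (#|(\val B :&: \val L)%SET| + 1) *
            (V B (subvector y B))%:num).
Proof.
move=> m0 VP; split=> [[H specH VE] y L|Vge0].
  have VE' B : (V B (subvector y B))%:num = spectral_max H y (\val B).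
    by apply: EFin_inj; rewrite VE EFin_spectral_max.
  under eq_bigr do rewrite VE'.
  rewrite sum_nonempty_subset ?spectral_max0//.
  by apply: spectral_max_alt_sum_ge0 => //; exact: (valP L).
have T0 : [set: 'I_m]%SET != finset.set0.
  by apply/finset.set0Pn; exists (Ordinal m0).
pose T : nonempty_subset m := exist _ finset.setT T0.
pose t i : elt T := exist _ i (finset.in_setT i).
have [H0 specH0 VT] := VP T.
have ts : cancel t val by [].
have st : cancel val t by move=> j; exact: val_inj.
(* The witness for consistency is the spectral measure of [V] at the full set, relabelled. *)
have [H specH HE] := ex_reindex_spectral_measure _ _ ts st H0 specH0.
have Valt : alternating_family (extension V).
  split=> [||B|y L L0]; [exact: extension0|exact: extension_set1|
    exact: extension_local|].
  rewrite -sum_nonempty_subset ?extension0//.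
  have := Vge0 y (exist _ L L0).
  by under eq_bigr do rewrite -extension_val.
exists H => // B y; rewrite -EFin_spectral_max//; congr EFin.
rewrite -extension_val; apply: alternating_family_eq => //.
  exact: spectral_max_alternating.
(* The two families agree at the full set by the choice of [H]. *)
move=> z; apply: EFin_inj.
rewrite -[finset.setT]/(\val T) extension_val VT -HE EFin_spectral_max//.
by apply: eq_integral => w _; congr EFin; apply: eq_bigl => j; rewrite /= inE.
Qed.
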